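(* Let $\lambda\in K$ be invertible and $T=\{D(x)D(y)+\lambda^{-1}D(x)y+\lambda^{-1}xD(y)-\lambda^{-1}D(xy)\mid x,y\in\mathfrak{S}(X)\}$. Then $K\langle X;D|T\rangle=K\langle X;D\rangle/Id(T)$ is a free $\lambda$-differential algebra on the set $X$ with $K$-basis $\Phi(X)$.
   Context: $K$ is a commutative ring with unit. A $\lambda$-differential algebra is an associative $K$-algebra $R$ with a $K$-linear $D:R\to R$ satisfying $D(xy)=D(x)y+xD(y)+\lambda D(x)D(y)$; free on $X$ means every map from $X$ to such an algebra extends uniquely to a homomorphism commuting with $D$. $S(Y)$ free semigroup; $\mathfrak{S}_0=S(X)$, $\mathfrak{S}_n=S(X\cup\{D(u)\mid u\in\mathfrak{S}_{n-1}\})$, $\mathfrak{S}(X)=\bigcup_n\mathfrak{S}_n$; $K\langle X;D\rangle$ free $K$-module on $\mathfrak{S}(X)$ with concatenation product and $D$ extended linearly; $Id(T)$ is the $K$-span of all $u|_t$, $u$ a word on $X\cup\{\star\}$ with exactly one $\star$, $t\in T$ substituted for $\star$. For $Y,Z\subseteq\mathfrak{S}(X)$: $\Lambda^D_X(Y,Z)=\bigcup_{r\ge1}(YD(Z))^r\cup\bigcup_{r\ge0}(YD(Z))^rY\cup\bigcup_{r\ge1}(D(Z)Y)^r\cup\bigcup_{r\ge0}(D(Z)Y)^rD(Z)$; $\Phi_0=S(X)$, $\Phi_n=\Lambda^D_X(\Phi_0,\Phi_{n-1})$, $\Phi(X)=\bigcup_{n\ge0}\Phi_n$. *)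

(* Defs.v *)
From HB Require Import structures.
From mathcomp Require Import all_boot all_order all_algebra.
Set Implicit Arguments. Unset Strict Implicit. Unset Printing Implicit Defensive.
Import GRing.Theory.
Local Open Scope ring_scope.

(* A letter is either a variable x in X or D(w) for a bracketed word w;
   a bracketed word is a NONEMPTY sequence of letters, represented as
   (first letter, remaining letters).  Words = the union of all S_n. *)
Inductive dletter (X : Type) : Type :=
  | LX of X
  | LD of dletter X & seq (dletter X).

Definition word (X : Type) : Type := (dletter X * seq (dletter X))%type.

Definition wcat (X : Type) (u v : word X) : word X := (u.1, u.2 ++ v.1 :: v.2).
Definition wX (X : Type) (x : X) : word X := (LX x, [::]).
Definition wD (X : Type) (u : word X) : word X := (LD u.1 u.2, [::]).

Definition is_var (X : Type) (l : dletter X) : bool :=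
  if l is LX _ then true else false.
Definition inSX (X : Type) (w : word X) : Prop := is_var w.1 && all (@is_var X) w.2.

Definition wprod (X : Type) (A B : word X -> Prop) (w : word X) : Prop :=
  exists u v, A u /\ B v /\ w = wcat u v.
Fixpoint rpow (X : Type) (A : word X -> Prop) (r : nat) (B : word X -> Prop)
  : word X -> Prop :=
  match r with
  | 0 => B
  | r'.+1 => wprod A (rpow A r' B)
  end.
Definition DSet (X : Type) (Z : word X -> Prop) (w : word X) : Prop :=
  exists z, Z z /\ w = wD z.
Definition LambdaD (X : Type) (Y Z : word X -> Prop) (w : word X) : Prop :=
  let YD := wprod Y (DSet Z) in
  let DY := wprod (DSet Z) Y in
  (exists r, rpow YD r YD w)          (* U_{r>=1} (Y D(Z))^r   *)
  \/ (exists r, rpow YD r Y w)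
  \/ (exists r, rpow DY r DY w)       (* U_{r>=1} (D(Z) Y)^r   *)
  \/ (exists r, rpow DY r (DSet Z) w).
Fixpoint PhiN (X : Type) (n : nat) : word X -> Prop :=
  match n with
  | 0 => @inSX X
  | n'.+1 => LambdaD (@inSX X) (PhiN n')
  end.
Definition Phi (X : Type) (w : word X) : Prop := exists n, PhiN n w.

Definition deval (Y A : Type) (m : A -> A -> A) (D : A -> A) (f : Y -> A)
  : dletter Y -> A :=
  fix ev l := match l with
    | LX y => f y
    | LD a s => D ((fix go acc s := match s with
                     | [::] => acc
                     | b :: s' => go (m acc (ev b)) s'
                     end) (ev a) s)
    end.
Definition devalw (Y A : Type) (m : A -> A -> A) (D : A -> A) (f : Y -> A)
  (w : word Y) : A :=
  foldl (fun acc b => m acc (deval m D f b)) (deval m D f w.1) w.2.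

(* ---------- star-words (words on X u {star}, star = None) ---------- *)
Fixpoint nstar (X : Type) (l : dletter (option X)) : nat :=
  match l with
  | LX None => 1
  | LX (Some _) => 0
  | LD a s => nstar a + (fix go s := match s with
                                    | [::] => 0
                                    | b :: s' => nstar b + go s'
                                    end) s
  end.
Definition one_star (X : Type) (u : word (option X)) : Prop :=
  nstar u.1 + sumn (map (@nstar X) u.2) = 1.

Section Alg.
Variable K : pzRingType.

Definition is_linmap (U V : lmodType K) (f : U -> V) : Prop :=
  forall (k : K) a b, f (k *: a + b) = k *: f a + f b.

Definition is_bilinear (V : lmodType K) (m : V -> V -> V) : Prop :=
  (forall (k : K) a b c, m (k *: a + b) c = k *: m a c + m b c) /\
  (forall (k : K) a b c, m a (k *: b + c) = k *: m a b + m a c).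

Definition is_basis (V : lmodType K) (I : Type) (S : I -> Prop) (f : I -> V)
  : Prop :=
  (forall v : V, exists n (k : 'I_n -> K) (i : 'I_n -> I),
      (forall j, S (i j)) /\ v = \sum_(j < n) k j *: f (i j)) /\
  (forall n (k : 'I_n -> K) (i : 'I_n -> I), injective i ->
      (forall j, S (i j)) -> \sum_(j < n) k j *: f (i j) = 0 ->
      forall j, k j = 0).

Definition is_ldiff_alg (lam : K) (A : lmodType K) (m : A -> A -> A)
  (D : A -> A) : Prop :=
  [/\ is_bilinear m, associative m, is_linmap D &
      forall x y, D (m x y) = m (D x) y + m x (D y) + lam *: m (D x) (D y)].

Definition is_ophom (A B : lmodType K) (mA : A -> A -> A) (DA : A -> A)
  (mB : B -> B -> B) (DB : B -> B) (h : A -> B) : Prop :=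
  [/\ is_linmap h, forall x y, h (mA x y) = mB (h x) (h y) &
      forall x, h (DA x) = DB (h x)].

Definition is_free_ldiff (lam : K) (X : Type) (A : lmodType K)
  (m : A -> A -> A) (D : A -> A) (i : X -> A) : Prop :=
  is_ldiff_alg lam m D /\
  forall (R : lmodType K) (mR : R -> R -> R) (DR : R -> R),
    is_ldiff_alg lam mR DR ->
    forall f : X -> R,
      exists h : A -> R,
        [/\ is_ophom m D mR DR h, (forall x, h (i x) = f x) &
            forall h' : A -> R, is_ophom m D mR DR h' ->
              (forall x, h' (i x) = f x) -> forall a, h' a = h a].

Definition is_KXD (X : Type) (P : lmodType K) (m : P -> P -> P) (D : P -> P)
  (e : word X -> P) : Prop :=
  [/\ is_basis (fun _ => True) e, is_bilinear m,
      (forall u v, m (e u) (e v) = e (wcat u v)), is_linmap D &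
      forall u, D (e u) = e (wD u)].

Definition subst_star (X : Type) (P : lmodType K) (m : P -> P -> P)
  (D : P -> P) (e : word X -> P) (u : word (option X)) (t : P) : P :=
  devalw m D (fun o => match o with Some x => e (wX x) | None => t end) u.

Definition IdT (X : Type) (P : lmodType K) (m : P -> P -> P) (D : P -> P)
  (e : word X -> P) (T : P -> Prop) (p : P) : Prop :=
  exists n (k : 'I_n -> K) (u : 'I_n -> word (option X)) (t : 'I_n -> P),
    [/\ forall j, one_star (u j), forall j, T (t j) &
        p = \sum_(j < n) k j *: subst_star m D e (u j) (t j)].

(* T = { D(x)D(y) + mu D(x)y + mu xD(y) - mu D(xy) | x, y in frak S(X) },
   where mu = lam^{-1} *)
Definition Tset (X : Type) (P : lmodType K) (m : P -> P -> P) (D : P -> P)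
  (e : word X -> P) (mu : K) (t : P) : Prop :=
  exists x y : word X,
    t = m (D (e x)) (D (e y)) + mu *: m (D (e x)) (e y)
        + mu *: m (e x) (D (e y)) - mu *: D (e (wcat x y)).

End Alg.

(* Main.v *)
Require Import Defs.
From HB Require Import structures.
From mathcomp Require Import all_boot all_order all_algebra.
From mathcomp Require Import boolp functions.
Import GRing.Theory.
Local Open Scope ring_scope.

(* Put E := 1 + lam D.  As lam is invertible, the lam-Leibniz rule says exactly
   that E is an algebra endomorphism, and D = mu (E - 1).  Hence free
   lam-differential algebras look like free associative algebras on the letters
   E^n x, i.e. on X * nat, with E acting as the shift of levels.  Expanding a
   bracketed word w by D = mu (E - 1) gives a power of mu times a leading word
   [leads w] (every D replaced by a shift), plus words of the same length with a
   smaller sum of levels.  On Phi(X) the leading word map is a bijection onto the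
   nonempty level words, its inverse grouping maximal blocks of positive level
   under a D; unitriangularity then gives both spanning (in the quotient) and
   independence (by mapping to noncommutative power series on X * nat). *)

Set Implicit Arguments. Unset Strict Implicit. Unset Printing Implicit Defensive.

(** * Mutual induction on letters and sequences of letters *)

Section DLetterInd.
Variables (X : Type) (Pl : dletter X -> Prop) (Ps : seq (dletter X) -> Prop).
Hypotheses (PX : forall x, Pl (LX x)) (PD : forall a s, Ps (a :: s) -> Pl (LD a s)).
Hypotheses (P0 : Ps [::]) (PS : forall a s, Pl a -> Ps s -> Ps (a :: s)).

Fixpoint dletter_mut_ind (l : dletter X) : Pl l :=
  match l with
  | LX x => PX x
  | LD a s =>
      PD (PS (dletter_mut_ind a)
        ((fix go s : Ps s :=
           match s with
           | [::] => P0
           | b :: s' => PS (dletter_mut_ind b) (go s')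
           end) s))
  end.

Lemma dseq_mut_ind s : Ps s.
Proof. by elim: s => [|a s IH]; [exact: P0 | apply: PS => //; exact: dletter_mut_ind]. Qed.

End DLetterInd.

(** * Level words and their correspondence with normal words *)

Section LevelWords.
Variable X : Type.
Implicit Types (l a b : dletter X) (s r : seq (dletter X)) (t : seq (X * nat)).

Definition wseq (w : word X) : seq (dletter X) := w.1 :: w.2.
(** The action of E on level words. *)
Definition shift t : seq (X * nat) := [seq (p.1, p.2.+1) | p <- t].
Definition weight t : nat := sumn [seq p.2 | p <- t].

Lemma weight_cat t1 t2 : weight (t1 ++ t2) = (weight t1 + weight t2)%N.
Proof. by rewrite /weight map_cat sumn_cat. Qed.

Lemma weight_shift t : weight (shift t) = (weight t + size t)%N.
Proof.
by elim: t => //= -[x n] t; rewrite /weight /= => ->; rewrite addnS addnA.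
Qed.

Lemma size_shift t : size (shift t) = size t.
Proof. exact: size_map. Qed.

Fixpoint leadl l : seq (X * nat) :=
  match l with
  | LX x => [:: (x, 0%N)]
  | LD a s => shift (leadl a ++
      (fix go s := if s is b :: s' then leadl b ++ go s' else [::]) s)
  end.
Definition leads s := flatten (map leadl s).

Lemma leadlD a s : leadl (LD a s) = shift (leads (a :: s)).
Proof. by congr (shift (_ ++ _)); elim: s => //= b s ->. Qed.

Lemma leads_cons a s : leads (a :: s) = leadl a ++ leads s.
Proof. by []. Qed.

(** Needed because [evlevels] is multiplicative on nonempty level words only. *)
Lemma size_leads_cons a s : (0 < size (leads (a :: s)))%N.
Proof.
rewrite leads_cons size_cat ltn_addr //.
move: a {s}; apply: (@dletter_mut_ind _ _
  (fun s => if s is _ :: _ then 0 < size (leads s) else true)%N) => //;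
  by move=> a s; rewrite ?leadlD ?size_shift // leads_cons size_cat => h _; rewrite ltn_addr.
Qed.

(* The words of Phi(X): no two adjacent factors D(u)D(v), at any depth. *)
Definition compat a b := is_var a || is_var b.
Fixpoint normal_letter l : bool :=
  match l with
  | LX _ => true
  | LD a s => [&& normal_letter a,
      (fix go s := if s is b :: s' then normal_letter b && go s' else true) s
      & path compat a s]
  end.
Definition normal s := all normal_letter s && sorted compat s.

Lemma normal_letterD a s : normal_letter (LD a s) = normal (a :: s).
Proof.
by rewrite /normal /= -andbA; congr [&& _, _ & _]; elim: s => //= b s ->.
Qed.

Lemma normal_cons a s :
  normal (a :: s) = [&& normal_letter a, (if s is b :: _ then compat a b else true) & normal s].
Proof.
rewrite /normal; case: s => [|b s] /=; first by rewrite !andbT.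
by rewrite -!andbA; do !bool_congr.
Qed.

(* Prepends the level letter (x, n): a positive level goes inside a leading D if
   there is one, and otherwise opens a new D, so no two D's become adjacent. *)
Fixpoint insert_word x n s : word X :=
  match n with
  | 0 => (LX x, s)
  | n'.+1 =>
      match s with
      | LD a s' :: r => let w := insert_word x n' (a :: s') in (LD w.1 w.2, r)
      | _ => let w := insert_word x n' [::] in (LD w.1 w.2, s)
      end
  end.
Definition insert (p : X * nat) s := wseq (insert_word p.1 p.2 s).
Definition group_levels t := foldr insert [::] t.

(** Each D entered by the insertion lowers the remaining level by one, and [leads] restores it by
    the [shift] attached to that D. *)
Lemma leads_insert_word x n s : leads (wseq (insert_word x n s)) = (x, n) :: leads s.
Proof.
elim: n s => [|n IH] [|[y|a s'] r] //=; rewrite /wseq /= leads_cons leadlD -/(wseq _) IH //.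
by rewrite [in RHS]leads_cons leadlD.
Qed.

Lemma leads_group_levels t : leads (group_levels t) = t.
Proof. by elim: t => //= -[x n] t IH; rewrite /insert leads_insert_word IH. Qed.

Lemma normal_insert_word x n s : normal s -> normal (wseq (insert_word x n s)).
Proof.
elim: n s => [|n IH] s.
  by rewrite /wseq normal_cons /= => ->; case: s.
case: s => [|[y|a s'] r] ns; rewrite /wseq /= normal_cons normal_letterD -/(wseq _).
- by rewrite IH.
- by rewrite IH.
- by move: ns; rewrite normal_cons normal_letterD => /and3P[na cr nr]; rewrite IH // cr.
Qed.

Lemma normal_group_levels t : normal (group_levels t).
Proof. by elim: t => //= -[x n] t; apply: normal_insert_word. Qed.

(** As [s] does not begin with a D, the last shifted letter opens a new D in front of [s]. Every
    earlier letter then enters this D, inside which the lowered levels are grouped as if there were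
    no shift. *)
Lemma foldr_insert_shift (p : X * nat) t s w : (if s is b :: _ then is_var b else true) ->
  group_levels (p :: t) = wseq w ->
  foldr insert s (shift (p :: t)) = LD w.1 w.2 :: s.
Proof.
move=> hs; elim: t p w => [|b t IH] [x n] w.
  by rewrite /= /insert; case: s hs => [|[y|c s'] r] //= _;
    case: insert_word => a1 s1; case: w => a2 s2 [-> ->].
have [w' hw'] : exists w', group_levels (b :: t) = wseq w' by exists (insert_word b.1 b.2 (group_levels t)).
rewrite -[group_levels _]/(insert (x, n) (group_levels (b :: t))).
rewrite -[foldr _ _ _]/(insert (x, n.+1) (foldr insert s (shift (b :: t)))).
rewrite (IH _ _ hw') hw' /insert /= -/(wseq w').
by case: insert_word => a1 s1; case: w => a2 s2 [-> ->].
Qed.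

(** The claim on a letter carries an arbitrary tail [r], since insertion depends on what follows.
    After a D, normality leaves a variable or nothing, as [foldr_insert_shift] requires. *)
Lemma group_levels_leads s : normal s -> group_levels (leads s) = s.
Proof.
move: s; apply: (@dseq_mut_ind _ (fun l => forall r, normal (l :: r) ->
  foldr insert r (leadl l) = l :: r)) => // a s IH.
- move=> r; rewrite normal_cons normal_letterD leadlD => /and3P[/IH e cr _].
  have := size_leads_cons a s; case E: (leads _) e => [//|p t] e _.
  by rewrite (@foldr_insert_shift _ _ _ (a, s)) //; case: (r) cr.
- move=> IHs ns; rewrite leads_cons /group_levels foldr_cat -/(group_levels _) IHs ?IH //.
  by move: ns; rewrite normal_cons => /and3P[].
Qed.

Lemma leads_inj : {in normal &, injective leads}.
Proof. by move=> s r ns nr e; rewrite -(group_levels_leads ns) e group_levels_leads. Qed.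

End LevelWords.

(** * Identification of Phi(X) with the normal words *)

Section PhiNormal.
Variable X : Type.
Implicit Types (u v w : word X) (A B C Y Z : word X -> Prop).

Lemma wcatA u v w : wcat u (wcat v w) = wcat (wcat u v) w.
Proof. by rewrite /wcat /= -catA. Qed.

Lemma rpow_mono A B C r : (forall w, B w -> C w) -> forall w, rpow A r B w -> rpow A r C w.
Proof.
move=> BC; elim: r => //= r IH w [u [v [Au [Bv ->]]]].
by exists u, v; split=> //; split=> //; apply: IH.
Qed.

Lemma rpow_last A B r w : rpow A r (wprod A B) w -> rpow A r.+1 B w.
Proof.
elim: r w => //= r IH w [u [v [Au [Bv ->]]]].
by exists u, v; split=> //; split=> //; apply: IH.
Qed.

Lemma wprodA A B C w : wprod A (wprod B C) w -> wprod (wprod A B) C w.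
Proof.
move=> [u [_ [Au [[v [v' [Bv [Cv ->]]]] ->]]]].
by exists (wcat u v), v'; rewrite wcatA; split=> //; exists u, v.
Qed.

Lemma wprod_rpow A B C r w :
  wprod A (rpow (wprod B A) r C) w -> rpow (wprod A B) r (wprod A C) w.
Proof.
elim: r w => //= r IH w [u [_ [Au [[_ [v [[b [a [Bb [Aa ->]]]] [Cv ->]]]] ->]]]].
exists (wcat u b), (wcat a v); rewrite !wcatA; split; first by exists u, b.
by split=> //; apply: IH; exists a, v.
Qed.

(** Rebracketing absorbs the new factor: A(BA)^r BA = (AB)^(r+1) A and A(BA)^r B = (AB)^(r+1). Here
    [rpow C r C] stands for the power r+1 of C. *)
Lemma wprod_alternating A B w :
  (exists r, wprod A (rpow (wprod B A) r (wprod B A)) w) \/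
  (exists r, wprod A (rpow (wprod B A) r B) w) ->
  (exists r, rpow (wprod A B) r (wprod A B) w) \/
  (exists r, rpow (wprod A B) r A w).
Proof.
case=> -[r /wprod_rpow h]; last by left; exists r.
by right; exists r.+1; apply: rpow_last; apply: rpow_mono h; apply: wprodA.
Qed.

(** The variable joins the first S(X) factor, so the number of factors does not change. *)
Lemma rpow_var_cons Z x w :
  let YD := wprod (@inSX X) (DSet Z) in
  (exists r, rpow YD r YD w) \/ (exists r, rpow YD r (@inSX X) w) ->
  (exists r, rpow YD r YD (wcat (wX x) w)) \/
  (exists r, rpow YD r (@inSX X) (wcat (wX x) w)).
Proof.
move=> YD.
have h v : YD v -> YD (wcat (wX x) v).
  by move=> [y [d [Yy [Dd ->]]]]; rewrite wcatA; exists (wcat (wX x) y), d.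
case=> -[[|r] /=] => [/h|[u [v [/h u' [Bv ->]]]]|h'|[u [v [/h u' [Bv ->]]]]].
- by left; exists 0%N.
- by left; exists r.+1; rewrite wcatA; exists (wcat (wX x) u), v.
- by right; exists 0%N.
- by right; exists r.+1; rewrite wcatA; exists (wcat (wX x) u), v.
Qed.

(** Letters are prefixed one by one, and the kind of the first letter selects two of the four forms
    of [LambdaD]. A variable before a variable joins its factor; a change of kind switches to the
    other two forms by [wprod_alternating]. *)
Lemma alternating_LambdaD (q : pred (dletter X)) Z a s :
  (forall b r, q (LD b r) -> Z (b, r)) -> all q (a :: s) -> path (@compat X) a s ->
  let YD := wprod (@inSX X) (DSet Z) in
  let DY := wprod (DSet Z) (@inSX X) in
  if is_var a then
    (exists r, rpow YD r YD (a, s)) \/ (exists r, rpow YD r (@inSX X) (a, s))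
  else
    (exists r, rpow DY r DY (a, s)) \/ (exists r, rpow DY r (DSet Z) (a, s)).
Proof.
move=> qZ; elim: s a => [|b s IH] [x|c s'] /=.
- by right; exists 0%N.
- by rewrite andbT => /qZ Zc _; right; exists 0%N; exists (c, s').
- case/andP=> _ qs ps; move: (IH b qs ps) => /=; case: (is_var b) => h.
    exact: (@rpow_var_cons Z x (b, s)).
  by apply: wprod_alternating; case: h => -[r h]; [left|right]; exists r; exists (wX x), (b, s).
- case/andP=> /qZ Zc qs /andP[vb ps].
  have := IH b qs ps; rewrite -[is_var b]/(compat (LD c s') b) vb => h.
  have Dc : DSet Z (wD (c, s')) by exists (c, s').
  by apply: wprod_alternating; case: h => -[r h]; [left|right]; exists r;
    exists (wD (c, s')), (b, s).
Qed.

(** Nesting depth of D, which bounds the index n for which a normal word lies in [PhiN n]. *)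
Fixpoint depthl (l : dletter X) : nat :=
  match l with
  | LX _ => 0
  | LD a s => (maxn (depthl a)
      ((fix go s := if s is b :: s' then maxn (depthl b) (go s') else 0%N) s)).+1
  end.
Definition normal_depth_le n l := normal_letter l && (depthl l <= n)%N.

Lemma all_normal_depth_leD n a s : all (normal_depth_le n) (a :: s) =
  all (@normal_letter X) (a :: s) && (depthl (LD a s) <= n.+1)%N.
Proof.
rewrite all_predI; congr (_ && _); rewrite /= ltnS geq_max; congr (_ && _).
by elim: s => //= b s ->; rewrite geq_max.
Qed.

Lemma normal_PhiN n w :
  all (normal_depth_le n) (wseq w) -> sorted (@compat X) (wseq w) -> PhiN n w.
Proof.
elim: n w => [|n IH] [a s].
  by move=> h _; apply: (@sub_all _ (normal_depth_le 0)) h => -[|a' s'] //; rewrite /normal_depth_le andbF.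
move=> /alternating_LambdaD h /h {}h.
have /h : forall b r, normal_depth_le n.+1 (LD b r) -> PhiN n (b, r).
  move=> b r; rewrite /normal_depth_le normal_letterD => /andP[/andP[nr sr] dr].
  by apply: IH => //; rewrite all_normal_depth_leD nr.
by rewrite /= /LambdaD; case: ifP => _ [] ?; tauto.
Qed.

Lemma normal_Phi w : normal (wseq w) -> Phi w.
Proof.
case: w => a s /andP[na sa]; exists (depthl (LD a s)).
by apply: normal_PhiN => //; rewrite all_normal_depth_leD na /= leqnSn.
Qed.

(** The kind of the first letter is recorded because prefixing D(z) preserves normality when a
    variable follows. *)
Definition normal_starting b w := normal (wseq w) /\ is_var w.1 = b.

Lemma normal_starting_cat_var y w : inSX y -> normal (wseq w) -> normal_starting true (wcat y w).
Proof.
case: y => a s /andP[/= va vs] nw; split=> //; rewrite /wseq /wcat /=.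
elim: s a va vs => [|b s IH] a va /=; last case/andP=> vb vs.
  by rewrite normal_cons nw /compat va; case: a va.
by rewrite normal_cons IH // /compat va; case: a va.
Qed.

Lemma inSX_normal_starting w : inSX w -> normal_starting true w.
Proof.
case: w => a s /andP[/= va vs]; split=> //; rewrite /wseq /=.
elim: s a va vs => [|b s IH] a va /=; last case/andP=> vb vs.
  by case: a va.
by rewrite normal_cons IH // /compat va; case: a va.
Qed.

Lemma DSet_normal_starting Z d : (forall z, Z z -> normal (wseq z)) -> DSet Z d -> normal_starting false d.
Proof.
by move=> nZ [z [/nZ nz ->]]; split=> //; rewrite /wseq normal_cons normal_letterD nz.
Qed.

Lemma normal_starting_cat_D Z d w : (forall z, Z z -> normal (wseq z)) -> DSet Z d ->
  normal_starting true w -> normal_starting false (wcat d w).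
Proof.
move=> nZ [z [/nZ nz ->]] [nw vw]; split=> //.
by rewrite /wseq /= normal_cons normal_letterD -/(wseq z) nz -/(wseq w) nw /compat vw orbT.
Qed.

Lemma LambdaD_normal Z w : (forall z, Z z -> normal (wseq z)) ->
  LambdaD (@inSX X) Z w -> normal (wseq w).
Proof.
move=> nZ.
have YD A r : (forall v, A v -> normal_starting true v) ->
    forall v, rpow (wprod (@inSX X) (DSet Z)) r A v -> normal_starting true v.
  move=> hA; elim: r => //= r IH v [_ [v' [[y [d [Yy [Dd ->]]]] [/IH sv ->]]]].
  by rewrite -wcatA; apply: normal_starting_cat_var => //; case: (normal_starting_cat_D nZ Dd sv).
have DY A r : (forall v, A v -> normal_starting false v) ->
    forall v, rpow (wprod (DSet Z) (@inSX X)) r A v -> normal_starting false v.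
  move=> hA; elim: r => //= r IH v [_ [v' [[d [y [Dd [Yy ->]]]] [/IH [nv _] ->]]]].
  by rewrite -wcatA; apply: normal_starting_cat_D nZ Dd _; apply: normal_starting_cat_var.
case=> [[r /YD]|[[r /YD]|[[r /DY]|[r /DY]]]] h.
- case: h => // v [y [d [Yy [Dd ->]]]].
  by apply: normal_starting_cat_var => //; case: (DSet_normal_starting nZ Dd).
- by case: h => //; apply: inSX_normal_starting.
- case: h => // v [d [y [Dd [Yy ->]]]].
  exact: normal_starting_cat_D nZ Dd (inSX_normal_starting Yy).
- by case: h => // v; apply: DSet_normal_starting.
Qed.

Lemma Phi_normal w : Phi w -> normal (wseq w).
Proof.
case=> n; elim: n w => [w /inSX_normal_starting[]//|n IH w].
exact: LambdaD_normal.
Qed.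

End PhiNormal.

(** * Spans, linear maps and bases *)

Section Span.
Variables (K : pzRingType) (V : lmodType K).
Implicit Types (S T : V -> Prop) (u v : V).

(** An inductive span lets properties pass from generators to combinations by [elim]; [lspan_sum]
    returns to the indexed sums of [is_basis]. *)
Inductive lspan S : V -> Prop :=
  | lspan0 : lspan S 0
  | lspanS k u v : S u -> lspan S v -> lspan S (k *: u + v).

Lemma lspanD S u v : lspan S u -> lspan S v -> lspan S (u + v).
Proof.
move=> Su Sv; elim: Su => [|k w u' Sw _ IH]; first by rewrite add0r.
by rewrite -addrA; apply: lspanS.
Qed.

Lemma lspanZ S k v : lspan S v -> lspan S (k *: v).
Proof.
elim=> [|c w u' Sw _ IH]; first by rewrite scaler0; apply: lspan0.
by rewrite scalerDr scalerA; apply: lspanS.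
Qed.

Lemma lspanB S u v : lspan S u -> lspan S v -> lspan S (u - v).
Proof. by move=> Su Sv; rewrite -scaleN1r; apply: lspanD => //; apply: lspanZ. Qed.

Lemma lspan_in S v : S v -> lspan S v.
Proof. by move=> Sv; rewrite -[v]addr0 -[X in X + 0]scale1r; apply/lspanS/lspan0. Qed.

Lemma lspan_sub S T v : (forall u, S u -> lspan T u) -> lspan S v -> lspan T v.
Proof.
move=> ST; elim=> [|k u w /ST Tu _ IH]; first exact: lspan0.
by apply: lspanD => //; apply: lspanZ.
Qed.

Lemma lspan_sum (I : Type) (S : I -> Prop) (f : I -> V) v :
  lspan (fun u => exists i, S i /\ u = f i) v ->
  exists n (k : 'I_n -> K) (i : 'I_n -> I),
    (forall j, S (i j)) /\ v = \sum_(j < n) k j *: f (i j).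
Proof.
elim=> [|k _ w [i [Si ->]] _ [n [c [g [Sg ->]]]]].
  (* [I] may be empty, so the empty family is built from the absurdity of j < 0. *)
  by exists 0%N, (fun _ => 0), (fun j : 'I_0 => False_rect _ (notF (ltn_ord j)));
    split=> [[]//|]; rewrite big_ord0.
exists n.+1, (fun j => oapp c k (unlift ord0 j)), (fun j => oapp g i (unlift ord0 j)).
split=> [j|]; first by case: unlift.
rewrite big_ord_recl unlift_none /=; congr (_ + _); apply: eq_bigr => j _.
by rewrite liftK.
Qed.

End Span.

Section LinearMaps.
Variables (K : pzRingType) (U V : lmodType K) (f : U -> V).
Hypothesis linf : is_linmap f.

Lemma linmapD a b : f (a + b) = f a + f b.
Proof. by have := linf 1 a b; rewrite !scale1r. Qed.

Lemma linmap0 : f 0 = 0.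
Proof. by apply: (addIr (f 0)); rewrite -linmapD !add0r. Qed.

Lemma linmapZ k a : f (k *: a) = k *: f a.
Proof. by have := linf k a 0; rewrite linmap0 !addr0. Qed.

Lemma linmapN a : f (- a) = - f a.
Proof. by rewrite -!scaleN1r linmapZ. Qed.

Lemma linmapB a b : f (a - b) = f a - f b.
Proof. by rewrite linmapD linmapN. Qed.

Lemma linmap_sum (I : Type) (r : seq I) (F : I -> U) :
  f (\sum_(i <- r) F i) = \sum_(i <- r) f (F i).
Proof. exact: (big_morph f linmapD linmap0). Qed.

Lemma lspan_linmap (S : U -> Prop) (T : V -> Prop) v :
  (forall u, S u -> lspan T (f u)) -> lspan S v -> lspan T (f v).
Proof.
move=> ST; elim=> [|k u w /ST Tu _ IH]; first by rewrite linmap0; apply: lspan0.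
by rewrite linf; apply: lspanD => //; apply: lspanZ.
Qed.

End LinearMaps.

Section LinearMapCombinators.
Variables (K : comPzRingType) (U V W : lmodType K).

Lemma linmap_comp (g : V -> W) (f : U -> V) :
  is_linmap g -> is_linmap f -> is_linmap (fun x => g (f x)).
Proof. by move=> ling linf k a b; rewrite linf ling. Qed.

Lemma linmap_add (f g : U -> V) :
  is_linmap f -> is_linmap g -> is_linmap (fun x => f x + g x).
Proof. by move=> linf ling k a b; rewrite linf ling scalerDr addrACA. Qed.

Lemma linmap_scale (c : K) (f : U -> V) : is_linmap f -> is_linmap (fun x => c *: f x).
Proof. by move=> linf k a b; rewrite linf scalerDr !scalerA mulrC. Qed.

End LinearMapCombinators.

Section Bilinear.
Variables (K : pzRingType) (V : lmodType K) (m : V -> V -> V).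
Hypothesis bil : is_bilinear m.

Lemma bilinear_left c : is_linmap (m^~ c).
Proof. by move=> k a b; rewrite bil.1. Qed.

Lemma bilinear_right a : is_linmap (m a).
Proof. by move=> k b c; rewrite bil.2. Qed.

End Bilinear.

Section Basis.
Variables (K : pzRingType) (V W : lmodType K) (I : Type) (e : I -> V).
Hypothesis basis_e : is_basis (fun _ => True) e.

Lemma basis_lspan v : lspan (fun u => exists i, u = e i) v.
Proof.
have [n [k [i [_ ->]]]] := basis_e.1 v.
elim/big_ind: _ => [|a b|j _]; [exact: lspan0|exact: lspanD|].
by apply/lspanZ/lspan_in; exists (i j).
Qed.

Lemma linmap_eq (f g : V -> W) : is_linmap f -> is_linmap g ->
  (forall i, f (e i) = g (e i)) -> forall v, f v = g v.
Proof.
move=> linf ling fg v; elim: (basis_lspan v) => [|k _ w [i ->] _ IH].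
  by rewrite !linmap0.
by rewrite linf ling fg IH.
Qed.

(** Independence in [is_basis] concerns injective families, so terms with the same index are first
    collected; [{classic I}] provides the equality test. *)
Lemma basis_rel (g : I -> W) (s : seq (K * I)) :
  \sum_(p <- s) p.1 *: e p.2 = 0 -> \sum_(p <- s) p.1 *: g p.2 = 0.
Proof.
pose s' : seq (K * {classic I}) := s; rewrite -/s'.
pose U := undup [seq p.2 | p <- s'].
pose c (i : {classic I}) := \sum_(p <- s' | p.2 == i) p.1.
have collect (Z : lmodType K) (h : {classic I} -> Z) :
    \sum_(p <- s') p.1 *: h p.2 = \sum_(i <- U) c i *: h i.
  under [RHS]eq_bigr do rewrite scaler_suml big_mkcond.
  rewrite exchange_big /=; apply: eq_big_seq => p ps.
  rewrite (bigD1_seq p.2) ?undup_uniq ?mem_undup ?map_f //= eqxx big1 ?addr0 // => i.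
  by rewrite eq_sym => /negbTE->.
rewrite !collect big_tnth => /basis_e.2 c0.
rewrite big_tnth big1 // => j _; rewrite c0 ?scale0r //.
have /tuple_uniqP injU : uniq (in_tuple U) by exact: undup_uniq.
exact: injU.
Qed.

(** A presentation of each vector is chosen; by [basis_rel] the resulting value does not depend on
    the presentation, whence linearity. *)
Lemma basis_extend (g : I -> W) : exists f : V -> W, is_linmap f /\ forall i, f (e i) = g i.
Proof.
have /choice[s sE] v : exists s : seq (K * I), v = \sum_(p <- s) p.1 *: e p.2.
  elim: (basis_lspan v) => [|k _ w [i ->] _ [s ->]]; first by exists [::]; rewrite big_nil.
  by exists ((k, i) :: s); rewrite big_cons.
pose f v := \sum_(p <- s v) p.1 *: g p.2.
have wd v (s' : seq (K * I)) : v = \sum_(p <- s') p.1 *: e p.2 ->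
    f v = \sum_(p <- s') p.1 *: g p.2.
  move=> vE; apply/eqP; rewrite -subr_eq0; apply/eqP.
  pose r := s v ++ [seq (- p.1, p.2) | p <- s'].
  have rE (Z : lmodType K) (h : I -> Z) : \sum_(p <- r) p.1 *: h p.2 =
      \sum_(p <- s v) p.1 *: h p.2 - \sum_(p <- s') p.1 *: h p.2.
    rewrite big_cat big_map -sumrN; congr (_ + _).
    by apply: eq_bigr => p _; rewrite scaleNr.
  by rewrite /f -rE; apply: basis_rel; rewrite rE -sE -vE subrr.
exists f; split=> [k a b|i].
  have comb (Z : lmodType K) (h : I -> Z) :
      \sum_(p <- [seq (k * p.1, p.2) | p <- s a] ++ s b) p.1 *: h p.2 =
      k *: (\sum_(p <- s a) p.1 *: h p.2) + \sum_(p <- s b) p.1 *: h p.2.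
    rewrite big_cat big_map scaler_sumr /=; congr (_ + _).
    by apply: eq_bigr => p _; rewrite scalerA.
  by rewrite (wd _ ([seq (k * p.1, p.2) | p <- s a] ++ s b)) comb // -!sE.
by rewrite (wd _ [:: (1, i)]) big_seq1 scale1r.
Qed.

End Basis.

(** * Evaluation of bracketed words *)

Section Deval.
Variables (Y A : Type) (m : A -> A -> A) (D : A -> A) (f : Y -> A).

Lemma devalD a s : deval m D f (LD a s) = D (devalw m D f (a, s)).
Proof. by []. Qed.

Hypothesis mA : associative m.

Lemma devalw_cons a b s :
  devalw m D f (a, b :: s) = m (deval m D f a) (devalw m D f (b, s)).
Proof.
rewrite /devalw /=; elim: s (deval m D f b) => //= c s IH acc.
by rewrite -mA IH.
Qed.

Lemma devalw_cat u v : devalw m D f (wcat u v) = m (devalw m D f u) (devalw m D f v).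
Proof.
case: u => a s; elim: s a => [|b s IH] a; rewrite /wcat /=.
  by rewrite devalw_cons; case: v.
by rewrite !devalw_cons -/(wcat (b, s) v) IH mA.
Qed.

End Deval.

Section DevalMorphism.
Variables (K : pzRingType) (A B : lmodType K).
Variables (mA : A -> A -> A) (DA : A -> A) (mB : B -> B -> B) (DB : B -> B) (h : A -> B).
Hypothesis homh : is_ophom mA DA mB DB h.
Variables (Y : Type) (g : Y -> A).

Lemma ophom_devalw w : h (devalw mA DA g w) = devalw mB DB (h \o g) w.
Proof.
case: homh => _ hm hD.
(* Evaluation folds to the left, so tails are followed from arbitrary corresponding accumulators. *)
pose F s := forall x y, h x = y ->
  h (foldl (fun acc b => mA acc (deval mA DA g b)) x s) =
  foldl (fun acc b => mB acc (deval mB DB (h \o g) b)) y s.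
pose W s := if s is a :: s' then h (devalw mA DA g (a, s')) = devalw mB DB (h \o g) (a, s')
  else True.
suff : W (wseq w) /\ F (wseq w) by case: w => a s [].
move: (wseq w); apply: (@dseq_mut_ind _ (fun l => h (deval mA DA g l) = deval mB DB (h \o g) l)).
- by [].
- by move=> a s [IH _]; rewrite !devalD hD IH.
- by split.
- move=> a s IHa [_ IHs]; split; first exact: IHs.
  by move=> x y xy; apply: IHs; rewrite hm xy IHa.
Qed.

End DevalMorphism.

Lemma nstarD (X : Type) (a : dletter (option X)) s :
  nstar (LD a s) = (nstar a + sumn (map (@nstar X) s))%N.
Proof. by congr addn; elim: s => //= b s ->. Qed.

(** The zero at the star propagates through products and D. Hence a morphism of operated algebras
    that kills T also kills Id(T). *)
Lemma devalw_star0 (K : pzRingType) (V : lmodType K) (m : V -> V -> V) (D : V -> V)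
    (X : Type) (g : option X -> V) (w : word (option X)) :
  is_bilinear m -> is_linmap D -> g None = 0 -> one_star w -> devalw m D g w = 0.
Proof.
move=> bil linD g0.
have m0l c : m 0 c = 0 := linmap0 (bilinear_left bil c).
have m0r c : m c 0 = 0 := linmap0 (bilinear_right bil c).
(* Either a star was already met, leaving a zero accumulator, or one is still to come. *)
pose F s := forall x, x = 0 \/ (0 < sumn (map (@nstar X) s))%N ->
  foldl (fun acc b => m acc (deval m D g b)) x s = 0.
pose W s := if s is a :: s' then (0 < nstar (LD a s'))%N -> devalw m D g (a, s') = 0
  else True.
suff : W (wseq w) /\ F (wseq w).
  by case: w => a s [h _] w1; apply: h; rewrite nstarD lt0n (w1 : (_ + _ = 1)%N).
move: (wseq w); apply: (@dseq_mut_ind _ (fun l => (0 < nstar l)%N -> deval m D g l = 0)).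
- by case.
- by move=> a s [IH _] h; rewrite devalD IH // linmap0.
- by split=> // x [].
- move=> a s IHa [_ IHs]; split=> [|x].
    by rewrite /W nstarD addn_gt0 => /orP[/IHa|] h; apply: IHs; [left|right].
  rewrite /= addn_gt0 => -[->|/orP[/IHa ->|h]]; apply: IHs; rewrite ?m0l ?m0r; by [left|right].
Qed.

(** * Triangular expansion in a lambda-differential algebra *)

Section LambdaDifferential.
Variables (K : comPzRingType) (lam mu : K).
Hypothesis lammu : lam * mu = 1.
Variables (A : lmodType K) (m : A -> A -> A) (D : A -> A).
Hypothesis ldiff : is_ldiff_alg lam m D.
Variables (X : Type) (f : X -> A).
Implicit Types (t u v : seq (X * nat)) (a b : A).

Let bil : is_bilinear m. Proof. by case: ldiff. Qed.
Let mA : associative m. Proof. by case: ldiff. Qed.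
Let linD : is_linmap D. Proof. by case: ldiff. Qed.

(** The operator E. *)
Definition twist a := a + lam *: D a.

Lemma twistM a b : twist (m a b) = m (twist a) (twist b).
Proof.
have linl c := bilinear_left bil c; have linr c := bilinear_right bil c.
case: ldiff => _ _ _ Leib; rewrite /twist Leib.
rewrite (linmapD (linl _)) (linmapZ (linl _)) !(linmapD (linr _)) !(linmapZ (linr _)).
by rewrite !scalerDr !scalerA !addrA; congr (_ + _); rewrite addrAC.
Qed.

Lemma D_twist a : D a = mu *: (twist a - a).
Proof. by rewrite /twist addrC addKr scalerA mulrC lammu scale1r. Qed.

Definition evlevel (p : X * nat) := iter p.2 twist (f p.1).
(* Junk value 0 at the empty word, as the algebra need not have a unit. *)
Definition evlevels t :=
  if t is p :: t' then foldl (fun acc q => m acc (evlevel q)) (evlevel p) t' else 0.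

Lemma evlevels_cons p q t : evlevels [:: p, q & t] = m (evlevel p) (evlevels (q :: t)).
Proof.
by rewrite /=; elim: t (evlevel q) => //= r t IH acc; rewrite -mA IH.
Qed.

Lemma evlevels_cat u v : (0 < size u)%N -> (0 < size v)%N ->
  evlevels (u ++ v) = m (evlevels u) (evlevels v).
Proof.
case: v => // q v; elim: u => [//|p [|r u] IH] _ _; rewrite !cat_cons.
  exact: evlevels_cons.
by rewrite !evlevels_cons -cat_cons IH // mA.
Qed.

Lemma evlevels_shift t : evlevels (shift t) = twist (evlevels t).
Proof.
elim: t => [|p [|q t] IH] //; first by rewrite /twist (linmap0 linD) scaler0 addr0.
by rewrite -[shift _]/[:: (p.1, p.2.+1), (q.1, q.2.+1) & shift t]
  !evlevels_cons -[(_, _) :: shift t]/(shift (q :: t)) IH twistM.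
Qed.

(** The error terms of the expansion. The length is fixed because applying E raises the weight by
    exactly the length. *)
Definition lower n N :=
  lspan (fun a => exists t, [/\ size t = n, (weight t < N)%N & a = evlevels t]).

Lemma lower_level t N : (weight t < N)%N -> lower (size t) N (evlevels t).
Proof. by move=> tN; apply: lspan_in; exists t. Qed.

Lemma lower_leq n N N' a : (N <= N')%N -> lower n N a -> lower n N' a.
Proof.
move=> NN'; apply: lspan_sub => _ [t [<- tN ->]]; apply: lower_level.
exact: leq_trans NN'.
Qed.

(** The bounds are strict: weights at most N-1 and N'-1 add up to at most N+N'-2, which is below M
    when N+N' <= M+1. *)
Lemma lowerM n n' N N' M a b : (0 < n)%N -> (0 < n')%N -> (N + N' <= M.+1)%N ->
  lower n N a -> lower n' N' b -> lower (n + n') M (m a b).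
Proof.
move=> n0 n0' NM la lb; move: la; apply: (lspan_linmap (bilinear_left bil b)).
move=> _ [t [tn tN ->]]; move: lb; apply: (lspan_linmap (bilinear_right bil _)).
move=> _ [t' [tn' tN' ->]]; rewrite -evlevels_cat ?tn ?tn' // -tn -tn' -size_cat.
apply: lower_level; rewrite weight_cat -ltnS (leq_trans _ NM) //.
by rewrite -addSn -addnS leq_add.
Qed.

Lemma lowerD n N a : (0 < n)%N -> lower n N a -> lower n (N + n) (D a).
Proof.
move=> n0; apply: (lspan_linmap linD) => _ [t [tn tN ->]].
rewrite D_twist -evlevels_shift; apply/lspanZ/lspanB.
  by rewrite -tn -size_shift; apply: lower_level; rewrite weight_shift size_shift ltn_add2r.
by rewrite -tn; apply: lower_level; apply: ltn_addr.
Qed.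

(** The leading coefficient is a power of [mu], hence invertible; the exponent produced below counts
    the occurrences of D. *)
Definition triangular t a :=
  exists k, lower (size t) (weight t) (a - mu ^+ k *: evlevels t).

Lemma triangularM t u a b : (0 < size t)%N -> (0 < size u)%N ->
  triangular t a -> triangular u b -> triangular (t ++ u) (m a b).
Proof.
move=> t0 u0 [k la] [j lb]; exists (k + j)%N.
have -> : m a b - mu ^+ (k + j) *: evlevels (t ++ u) =
    m (a - mu ^+ k *: evlevels t) b +
    mu ^+ k *: m (evlevels t) (b - mu ^+ j *: evlevels u).
  rewrite (linmapB (bilinear_left bil _)) (linmapZ (bilinear_left bil _)).
  rewrite (linmapB (bilinear_right bil _)) (linmapZ (bilinear_right bil _)).
  by rewrite scalerBr scalerA addrA subrK evlevels_cat // exprD.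
rewrite size_cat weight_cat; apply: lspanD; last first.
  by apply/lspanZ/(lowerM _ _ _ (lower_level (ltnSn _)) lb); rewrite ?addSn.
(* Here [b] still contains its leading term, so its bound is the weight of [u] plus one; the strict
   bound on the other factor compensates. *)
apply: (lowerM _ _ _ la (_ : lower _ (weight u).+1 b)); rewrite ?addnS //.
rewrite -[b](subrK (mu ^+ j *: evlevels u)); apply: lspanD.
  exact: lower_leq lb.
by apply/lspanZ/lower_level.
Qed.

Lemma triangularD t a : (0 < size t)%N -> triangular t a -> triangular (shift t) (D a).
Proof.
move=> t0 [k la]; exists k.+1; rewrite size_shift weight_shift.
(* D sends the leading word t to mu(E t - t): E t becomes the new leading word, and t is lower by
   its length, which is positive. *)
have -> : D a - mu ^+ k.+1 *: evlevels (shift t) =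
    D (a - mu ^+ k *: evlevels t) - mu ^+ k.+1 *: evlevels t.
  rewrite (linmapB linD) (linmapZ linD) [D (evlevels t)]D_twist evlevels_shift.
  by rewrite scalerA -exprSr scalerBr -addrA -opprD subrK.
apply: lspanB; first exact: lowerD.
by apply/lspanZ/lower_level; rewrite -addn1 leq_add2l.
Qed.

Lemma triangular_devalw w : triangular (leads (wseq w)) (devalw m D f w).
Proof.
pose W s := if s is a :: s' then triangular (leads s) (devalw m D f (a, s')) else True.
suff : W (wseq w) by case: w.
move: (wseq w); apply: (@dseq_mut_ind _ (fun l => triangular (leadl l) (deval m D f l))) => //.
- by move=> x; exists 0%N; rewrite scale1r subrr; apply: lspan0.
- by move=> a s IH; rewrite devalD leadlD; apply: triangularD => //; apply: size_leads_cons.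
- move=> a [|b s] IHa IHs; first by rewrite /W leads_cons cats0.
  rewrite /W leads_cons devalw_cons //; apply: triangularM => //; last exact: size_leads_cons.
  by have := size_leads_cons a [::]; rewrite leads_cons cats0.
Qed.

(** Induction on the weight: [group_levels] yields a word of Phi(X) with leading word t, multiplying
    by a power of [lam] inverts its leading coefficient, and the remaining level words have smaller
    weight and the same length. *)
Lemma evlevels_Phi t : (0 < size t)%N ->
  lspan (fun a => exists w, Phi w /\ a = devalw m D f w) (evlevels t).
Proof.
have [n] := ubnP (weight t); elim: n t => // n IH [//|p t]; rewrite ltnS => tn t0.
have nt := normal_group_levels (p :: t); have lt := leads_group_levels (p :: t).
pose w := insert_word p.1 p.2 (group_levels t); have dw : group_levels (p :: t) = wseq w by [].
rewrite dw in nt lt.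
have [k] := triangular_devalw w; rewrite lt => low.
have -> : evlevels (p :: t) = lam ^+ k *: (devalw m D f w -
    (devalw m D f w - mu ^+ k *: evlevels (p :: t))).
  by rewrite subKr scalerA -exprMn lammu expr1n scale1r.
apply/lspanZ/lspanB; first by apply: lspan_in; exists w; split=> //; apply: normal_Phi.
move: low; apply: lspan_sub => _ [u [su wu ->]]; apply: IH; rewrite ?su //.
exact: leq_trans wu _.
Qed.

Lemma devalw_Phi w : lspan (fun a => exists w, Phi w /\ a = devalw m D f w) (devalw m D f w).
Proof.
have [k low] := triangular_devalw w.
rewrite -[X in lspan _ X](subrK (mu ^+ k *: evlevels (leads (wseq w)))); apply: lspanD.
  move: low; apply: lspan_sub => _ [u [su _ ->]]; apply: evlevels_Phi.
  by rewrite su; apply: size_leads_cons.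
exact/lspanZ/evlevels_Phi/size_leads_cons.
Qed.

End LambdaDifferential.

(** * The model of noncommutative power series *)

Section SeriesModel.
Variables (K : comPzRingType) (lam mu : K).
Hypothesis lammu : lam * mu = 1.
Variable X : eqType.
Let Y := seq (X * nat).
Let M : lmodType K := (Y -> K^o).
Implicit Types (f g h : Y -> K) (s t u : Y).

(* The Cauchy product, sum of f(t) g(u) over all splittings s = t ++ u. *)
Fixpoint conv f g s : K :=
  match s with
  | [::] => f [::] * g [::]
  | a :: s' => f [::] * g (a :: s') + conv (fun t => f (a :: t)) g s'
  end.

(** The substitution raising all levels by one, on coefficients: the value at s is read at s with
    its levels lowered, and is 0 if some level is already 0. *)
Fixpoint shiftop f s : K :=
  match s with
  | [::] => f [::]
  | (x, 0) :: _ => 0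
  | (x, n.+1) :: s' => shiftop (fun t => f ((x, n) :: t)) s'
  end.

Definition diffop f : M := mu *: ((shiftop f : M) - (f : M)).

Lemma conv_linl k f g h s :
  conv (fun t => k * f t + g t) h s = k * conv f h s + conv g h s.
Proof.
elim: s f g => [|a s IH] f g /=; first by rewrite mulrDl mulrA.
by rewrite IH mulrDl mulrDr mulrA addrACA.
Qed.

Lemma conv_linr k f g h s :
  conv f (fun t => k * g t + h t) s = k * conv f g s + conv f h s.
Proof.
elim: s f => [|a s IH] f /=; first by rewrite mulrDr mulrCA.
by rewrite IH !mulrDr mulrCA addrACA.
Qed.

Lemma shiftop_lin k f g s :
  shiftop (fun t => k * f t + g t) s = k * shiftop f s + shiftop g s.
Proof.
by elim: s f g => [|[x [|n]] s IH] f g //=; rewrite mulr0 addr0.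
Qed.

Lemma conv0l g s : conv (fun _ => 0) g s = 0.
Proof. by elim: s => [|a s IH] /=; rewrite ?IH mul0r ?addr0. Qed.

Lemma shiftop0 s : shiftop (fun _ => 0) s = 0.
Proof. by elim: s => [|[x [|n]] s IH]. Qed.

Lemma convA f g h s : conv f (conv g h) s = conv (conv f g) h s.
Proof.
elim: s f g => [|a s IH] f g /=; first by rewrite mulrA.
by rewrite IH conv_linl mulrDr mulrA addrA.
Qed.

Lemma shiftopM f g s : shiftop (conv f g) s = conv (shiftop f) (shiftop g) s.
Proof.
elim: s f g => [|[x [|n]] s IH] f g //=; first by rewrite conv0l mulr0 addr0.
by rewrite (shiftop_lin (f [::]) (fun t => g ((x, n) :: t))) IH.
Qed.

Lemma conv_bilinear : is_bilinear (conv : M -> M -> M).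
Proof.
split=> [k f g h|k f g h]; apply: funext => s; first exact: conv_linl.
exact: conv_linr.
Qed.

Lemma diffop_linear : is_linmap (diffop : M -> M).
Proof.
move=> k f g; apply: funext => s.
change (mu * (shiftop (fun t => k * f t + g t) s - (k * f s + g s)) =
  k * (mu * (shiftop f s - f s)) + mu * (shiftop g s - g s)).
by rewrite shiftop_lin [k * (mu * _)]mulrCA -mulrDr; congr (mu * _); rewrite mulrBr opprD addrACA.
Qed.

Lemma twist_diffop f : twist lam (diffop : M -> M) f = shiftop f.
Proof. by rewrite /twist /diffop scalerA lammu scale1r addrC subrK. Qed.

Lemma series_ldiff : is_ldiff_alg lam (conv : M -> M -> M) (diffop : M -> M).
Proof.
split; [exact: conv_bilinear| |exact: diffop_linear|].
  by move=> f g h; apply: funext => s; apply: convA.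
have linl c := bilinear_left conv_bilinear c.
have linr c := bilinear_right conv_bilinear c.
move=> f g.
have -> : diffop (conv f g) = mu *: ((conv (shiftop f) (shiftop g) : M) - conv f g).
  by congr (mu *: (_ - _)); apply: funext => s; apply: shiftopM.
rewrite /diffop (linmapZ (linl _)) !(linmapZ (linr _)) (linmapZ (linl _)).
rewrite !scalerA lammu mul1r -!scalerDr; congr (_ *: _).
(* It remains to see that (F+f)(G+g) - fg = Fg + fG + FG. *)
set F : M := shiftop f - f; set G : M := shiftop g - g.
have -> : (shiftop f : M) = F + f by rewrite subrK.
have -> : (shiftop g : M) = G + g by rewrite subrK.
by rewrite (linmapD (linl _)) !(linmapD (linr _)) addrA addrK -addrA addrC.
Qed.

Definition delta t : M := fun s => (s == t)%:R.

Lemma delta_cons a b t :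
  (fun s => delta (b :: t) (a :: s)) = if a == b then delta t else fun _ => 0.
Proof. by apply: funext => s; rewrite /delta eqseq_cons; case: eqP. Qed.

Lemma conv_delta t u : conv (delta t) (delta u) = delta (t ++ u).
Proof.
apply: funext => s; elim: s t => [|a s IH] [|b t] /=; rewrite ?mul1r ?mul0r //.
  by rewrite conv0l addr0.
rewrite delta_cons add0r -[RHS]/((_ == _)%:R) eqseq_cons.
by have [_|ab] := eqVneq a b; [exact: IH | exact: conv0l].
Qed.

Lemma shiftop_delta t : shiftop (delta t) = delta (shift t).
Proof.
apply: funext => s; elim: s t => [|[x [|n]] s IH] [|[y k] t] //=.
- by rewrite /delta eqseq_cons xpair_eqE andbF.
- exact: shiftop0.
- rewrite delta_cons -[RHS]/((_ == _)%:R) eqseq_cons !xpair_eqE eqSS.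
  by case: (_ && _); [exact: IH | exact: shiftop0].
Qed.

Let gen (x : X) : M := delta [:: (x, 0%N)].
Let cnv : M -> M -> M := conv.
Let dff : M -> M := diffop.

(** Level words become indicator functions, so their coefficients in a combination can be read off
    by evaluation. *)
Lemma evlevels_delta t : (0 < size t)%N -> evlevels lam cnv dff gen t = delta t.
Proof.
have level p : evlevel lam dff gen p = delta [:: p].
  case: p => x n; rewrite /evlevel; elim: n => //= n ->.
  by rewrite twist_diffop shiftop_delta.
elim: t => // p [|q t] IH _; first exact: level.
by rewrite (evlevels_cons series_ldiff) IH // level; exact: conv_delta.
Qed.

Lemma lower_coef0 n N (a : M) s :
  lower lam cnv dff gen n N a -> (N <= weight s)%N -> a s = 0.
Proof.
move=> low Ns; elim: low => [//|k _ b [t [_ tN ->]] _ IH].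
rewrite -[LHS]/(k * _ s + b s) IH addr0.
(* The empty level word has the junk value 0. *)
case: t tN => [|p t] tN; first exact: mulr0.
rewrite evlevels_delta // /delta; case: eqP => [st|]; last by rewrite mulr0.
by rewrite -st ltnNge Ns in tN.
Qed.

Lemma devalw_coef w : exists d, forall s, (weight (leads (wseq w)) <= weight s)%N ->
  devalw cnv dff gen w s = mu ^+ d * (s == leads (wseq w))%:R.
Proof.
have [d low] := triangular_devalw lammu series_ldiff gen w.
exists d => s /(lower_coef0 low); rewrite evlevels_delta ?size_leads_cons //.
by move/eqP; rewrite subr_eq0 => /eqP.
Qed.

(** Among the nonzero coefficients, one whose leading word L has maximal weight is chosen. At L the
    other terms vanish, since leading words of distinct normal words differ, so this coefficient
    times a power of [mu] is 0. *)
Lemma Phi_independent n (k : 'I_n -> K) (w : 'I_n -> word X) :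
  injective w -> (forall j, Phi (w j)) ->
  \sum_(j < n) k j *: devalw cnv dff gen (w j) = 0 -> forall j, k j = 0.
Proof.
move=> injw Pw sum0 j0; apply/eqP/negP => /negP kj0.
pose L j := leads (wseq (w j)).
case: (@arg_maxnP _ j0 (fun j => k j != 0) (fun j => weight (L j)) kj0) => j kj maxj.
have injL i : L i = L j -> i = j.
  move=> /leads_inj E; apply: injw.
  have := E (Phi_normal (Pw i)) (Phi_normal (Pw j)).
  by rewrite /wseq; case: (w i) (w j) => [? ?] [? ?] [-> ->].
have [d coefj] := devalw_coef (w j).
have : k j * mu ^+ d = 0.
  transitivity ((0 : M) (L j)) => //; rewrite -sum0 fct_sumE.
  rewrite (bigD1 j) //= [X in _ + X]big1 ?addr0 => [|i ij].
    by rewrite -[RHS]/(k j * devalw cnv dff gen (w j) (L j)) coefj // eqxx mulr1.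
  rewrite -[LHS]/(k i * devalw cnv dff gen (w i) (L j)).
  have [->|ki] := eqVneq (k i) 0; first exact: mul0r.
  have [c ->] := devalw_coef (w i); last exact: maxj.
  by case: eqP => [E|_]; rewrite ?mulr0 //; rewrite (injL i) ?eqxx in ij.
move=> /(congr1 (fun x => x * lam ^+ d)).
rewrite mul0r -mulrA -exprMn [mu * _]mulrC lammu expr1n mulr1 => k0.
by rewrite k0 eqxx in kj.
Qed.

End SeriesModel.

(** * Freeness and basis of the quotient by Id(T) *)

Section Quotient.
Variables (K : comPzRingType) (lam mu : K).
Hypothesis lammu : lam * mu = 1.
Variables (X : Type) (P : lmodType K) (mP : P -> P -> P) (DP : P -> P) (e : word X -> P).
Hypothesis HP : is_KXD mP DP e.
Variables (Q : lmodType K) (mQ : Q -> Q -> Q) (DQ : Q -> Q) (pi : P -> Q).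
Hypothesis Hpi : is_ophom mP DP mQ DQ pi.
Hypothesis Hsurj : forall q : Q, exists p : P, pi p = q.
Hypothesis Hker : forall p : P, pi p = 0 <-> IdT mP DP e (Tset mP DP e mu) p.

Let basis_e : is_basis (fun _ => True) e. Proof. by case: HP. Qed.
Let bilP : is_bilinear mP. Proof. by case: HP. Qed.
Let linDP : is_linmap DP. Proof. by case: HP. Qed.
Let linpi : is_linmap pi. Proof. by case: Hpi. Qed.
Let piM x y : pi (mP x y) = mQ (pi x) (pi y). Proof. by case: Hpi. Qed.
Let piD x : pi (DP x) = DQ (pi x). Proof. by case: Hpi. Qed.
Let eM u v : mP (e u) (e v) = e (wcat u v). Proof. by case: HP. Qed.
Let eD u : DP (e u) = e (wD u). Proof. by case: HP. Qed.

Lemma KXD_mulA : associative mP.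
Proof.
have linl c := bilinear_left bilP c; have linr c := bilinear_right bilP c.
move=> a b c; move: a; apply: (linmap_eq basis_e).
- exact: linl.
- by move=> k x y; rewrite !(linl _ k).
move=> u; move: b; apply: (linmap_eq basis_e).
- by move=> k x y; rewrite (linl _ k) (linr _ k).
- by move=> k x y; rewrite (linr _ k) (linl _ k).
move=> v; move: c; apply: (linmap_eq basis_e).
- by move=> k x y; rewrite !(linr _ k).
- exact: linr.
by move=> w; rewrite !eM wcatA.
Qed.

(** Each basis vector is the evaluation of its own word at the variables, so operated morphisms are
    determined by their values on X. *)
Lemma KXD_devalw w : devalw mP DP (fun x => e (wX x)) w = e w.
Proof.
pose W s := if s is a :: s' then devalw mP DP (fun x => e (wX x)) (a, s') = e (a, s') else True.
suff : W (wseq w) by case: w.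
move: (wseq w); apply: (@dseq_mut_ind _ (fun l => deval mP DP (fun x => e (wX x)) l = e (l, [::]))) => //.
  by move=> a s IH; rewrite devalD IH eD.
move=> a [|b s] IHa IHs; first exact: IHa.
by rewrite /W (devalw_cons _ _ KXD_mulA) IHa IHs eM.
Qed.

(** The laws descend along the surjection [pi]. Leibniz reduces by bilinearity to basis words, where
    it is [lam] times a relation of T. *)
Lemma quotient_ldiff : is_ldiff_alg lam mQ DQ.
Proof.
have linl c := bilinear_left bilP c; have linr c := bilinear_right bilP c.
split.
- split=> k a b c; case: (Hsurj a) (Hsurj b) (Hsurj c) => [x <-] [y <-] [z <-].
    by rewrite -linpi -!piM (linl _ k) linpi.
  by rewrite -linpi -!piM (linr _ k) linpi.
- move=> a b c; case: (Hsurj a) (Hsurj b) (Hsurj c) => [x <-] [y <-] [z <-].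
  by rewrite -!piM KXD_mulA.
- move=> k a b; case: (Hsurj a) (Hsurj b) => [x <-] [y <-].
  by rewrite -linpi -!piD linDP linpi.
move=> a b; case: (Hsurj a) (Hsurj b) => [x <-] [y <-].
rewrite -!piD -!piM -piD -(linmapZ linpi) -!(linmapD linpi).
move: x; apply: (linmap_eq basis_e).
- exact/(linmap_comp linpi)/(linmap_comp linDP).
- apply: (linmap_comp linpi); apply/linmap_add/linmap_scale; first apply: linmap_add;
    by [exact: linl | exact: (linmap_comp (linl _) linDP)].
move=> u; move: y; apply: (linmap_eq basis_e).
- exact/(linmap_comp linpi)/(linmap_comp linDP).
- apply: (linmap_comp linpi); apply/linmap_add/linmap_scale; first apply: linmap_add;
    by [exact: linr | exact: (linmap_comp (linr _) linDP)].
move=> v.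
set t := mP (DP (e u)) (DP (e v))
    + mu *: mP (DP (e u)) (e v) + mu *: mP (e u) (DP (e v)) - mu *: DP (e (wcat u v)).
have /Hker : IdT mP DP e (Tset mP DP e mu) t.
  (* The word consisting of the star alone shows that T lies in Id(T). *)
  exists 1%N, (fun _ => 1), (fun _ => (LX None, [::])), (fun _ => t); split=> //.
    by move=> _; exists u, v.
  by rewrite big_ord1 scale1r.
move/(congr1 ( *:%R lam)); rewrite scaler0 -(linmapZ linpi) /t scalerBr !scalerDr.
rewrite !scalerA lammu !scale1r (linmapB linpi) => /eqP; rewrite subr_eq0 eM => /eqP <-.
by congr pi; rewrite [RHS]addrC addrA.
Qed.

(** Evaluation of words in R extends linearly to F. Leibniz in R, multiplied by [mu], says that F
    kills T, hence Id(T), so F factors through [pi]. *)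
Lemma quotient_free : is_free_ldiff lam mQ DQ (fun x : X => pi (e (wX x))).
Proof.
split; first exact: quotient_ldiff.
move=> R mR DR ldR f; case: (ldR) => bilR mAR linDR LeibR.
have [F [linF Fe]] := basis_extend basis_e (fun w => devalw mR DR f w).
have homF : is_ophom mP DP mR DR F.
  split=> // [x y|x].
    move: x; apply: (linmap_eq basis_e) => [k a b|k a b|u].
    - by rewrite bilP.1 linF.
    - by rewrite linF bilR.1.
    move: y; apply: (linmap_eq basis_e) => [k a b|k a b|v].
    - by rewrite bilP.2 linF.
    - by rewrite linF bilR.2.
    by rewrite eM !Fe devalw_cat.
  move: x; apply: (linmap_eq basis_e) => [k a b|k a b|u].
  - by rewrite linDP linF.
  - by rewrite linF linDR.
  by rewrite eD !Fe.
have [_ FM FD] := homF.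
have FT t : Tset mP DP e mu t -> F t = 0.
  move=> [x [y ->]]; rewrite (linmapB linF) !(linmapD linF) !(linmapZ linF) -eM.
  rewrite FD !FM !FD LeibR !scalerDr scalerA [mu * lam]mulrC lammu scale1r.
  by rewrite [X in _ - X]addrC addrA subrr.
have FId p : pi p = 0 -> F p = 0.
  move/Hker => [n [k [u [t [u1 Tt ->]]]]]; rewrite (linmap_sum linF) big1 // => j _.
  rewrite (linmapZ linF) /subst_star (ophom_devalw homF) (devalw_star0 bilR linDR) ?scaler0 //=.
  exact: FT.
(* The factored map is F after a set-theoretic section of [pi]; [FE] shows that the choice of
   preimage does not matter. *)
have [sec secK] := choice Hsurj.
have FE p : F (sec (pi p)) = F p.
  apply/eqP; rewrite -subr_eq0 -(linmapB linF); apply/eqP/FId.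
  by rewrite (linmapB linpi) secK subrr.
have onpi (q : Q) : exists p, q = pi p by exists (sec q).
exists (F \o sec); split.
- split=> [k a b|a b|a] /=.
  + by case: (onpi a) (onpi b) => x -> [y ->]; rewrite -linpi !FE linF.
  + by case: (onpi a) (onpi b) => x -> [y ->]; rewrite -piM !FE FM.
  + by case: (onpi a) => x ->; rewrite -piD !FE FD.
- by move=> x; rewrite /= FE Fe.
- move=> h' homh' h'f a; case: (onpi a) => x -> /=; rewrite FE.
  move: x; apply: (linmap_eq basis_e) => // [k x y|w].
    by case: homh' => linh' _ _; rewrite linpi linh'.
  rewrite Fe -{1}KXD_devalw (ophom_devalw Hpi) (ophom_devalw homh').
  by congr devalw; apply: funext.
Qed.

Lemma pi_devalw w : pi (e w) = devalw mQ DQ (fun x => pi (e (wX x))) w.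
Proof. by rewrite -{1}KXD_devalw (ophom_devalw Hpi). Qed.

Lemma quotient_basis : is_basis (@Phi X) (fun w : word X => pi (e w)).
Proof.
split=> [q|n k w injw Pw].
  apply: (@lspan_sum _ _ _ (@Phi X) (fun w => pi (e w))); have [p <-] := Hsurj q.
  move: (basis_lspan basis_e p); apply: (lspan_linmap linpi) => _ [w ->].
  rewrite pi_devalw; apply: lspan_sub (devalw_Phi lammu quotient_ldiff _ w).
  by move=> _ [v [Pv ->]]; apply: lspan_in; exists v; rewrite pi_devalw.
(* Freeness gives a morphism from the quotient to the series model sending x to the level letter (x,
   0); it carries a linear relation to one covered by [Phi_independent]. *)
have [_ /(_ _ _ _ (series_ldiff lammu {classic X}))] := quotient_free.
move=> /(_ (fun x => @delta K {classic X} [:: (x, 0%N)])) [h [homh hf _]] sum0.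
apply: (@Phi_independent _ _ _ lammu {classic X} _ _ _ injw Pw).
case: (homh) => linh _ _.
rewrite -[RHS](linmap0 linh) -sum0 (linmap_sum linh); apply: eq_bigr => j _.
rewrite (linmapZ linh) pi_devalw (ophom_devalw homh); congr (_ *: devalw _ _ _ _).
by apply: funext => x; rewrite /= hf.
Qed.

End Quotient.

Unset Implicit Arguments. Set Strict Implicit. Set Printing Implicit Defensive.

(* (P, mP, DP, e) is K<X;D>; (Q, mQ, DQ) together with the surjective
   operated-algebra map pi : P -> Q whose kernel is exactly Id(T) is the
   quotient K<X;D|T> = K<X;D>/Id(T).  mu is lam^{-1}. *)
Theorem theorem5p8 (K : comPzRingType) (lam mu : K) (Hinv : lam * mu = 1)
  (X : Type)
  (P : lmodType K) (mP : P -> P -> P) (DP : P -> P) (e : word X -> P)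
  (HP : is_KXD mP DP e)
  (Q : lmodType K) (mQ : Q -> Q -> Q) (DQ : Q -> Q) (pi : P -> Q)
  (Hpi : is_ophom mP DP mQ DQ pi)
  (Hsurj : forall q : Q, exists p : P, pi p = q)
  (Hker : forall p : P, pi p = 0 <-> IdT mP DP e (Tset mP DP e mu) p) :
  is_free_ldiff lam mQ DQ (fun x : X => pi (e (wX x))) /\
  is_basis (@Phi X) (fun w : word X => pi (e w)).
Proof.
split; first exact (quotient_free Hinv HP Hpi Hsurj Hker).
exact (quotient_basis Hinv HP Hpi Hsurj Hker).
Qed.
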